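(* Let $\rho\ge 0$ and let $f:\mathbb{R}^n\to\overline{\mathbb{R}}$ be a proper closed $\rho$-weakly convex function with $f^\star=\min_{x\in\mathbb{R}^n} f(x)$ and $S=\operatorname{argmin}_{x\in\mathbb{R}^n} f(x)$. Suppose $S\neq\emptyset$, and let $\nu>0$ be the same constant throughout the conditions (SC), (RSI), (EB), (PL), (QG) defined in the context. Then $$(\mathrm{SC})\Rightarrow(\mathrm{RSI})\Rightarrow(\mathrm{EB})\Leftrightarrow(\mathrm{PL})\Rightarrow(\mathrm{QG}).$$ Furthermore, if the coefficient in (QG) satisfies $\mu_{\mathrm q}>\rho$ (including the case that $f$ is convex, where $\rho=0$ and any $\mu_{\mathrm q}>0$ is allowed), then $$(\mathrm{RSI})\Leftrightarrow(\mathrm{EB})\Leftrightarrow(\mathrm{PL})\Leftrightarrow(\mathrm{QG});$$ that is, (QG) with a constant $\mu_{\mathrm q}>\rho$ implies (RSI), and hence (EB) and (PL) as well.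
   Context: $\overline{\mathbb{R}}=\mathbb{R}\cup\{\pm\infty\}$; $\|\cdot\|$ is the Euclidean norm. $f$ is proper if $f>-\infty$ everywhere and $f(x)<\infty$ for some $x$; closed if its epigraph is closed. $f$ is $\rho$-weakly convex if $f+\frac{\rho}{2}\|\cdot\|^2$ is convex. The Fréchet subdifferential at a point $x$ with $f(x)$ finite is $$\hat\partial f(x)=\Big\{s\in\mathbb{R}^n : \liminf_{y\to x}\frac{f(y)-f(x)-\langle s,y-x\rangle}{\|y-x\|}\ge 0\Big\}.$$ For a closed set $C$, $\mathrm{dist}(x,C)=\min_{y\in C}\|x-y\|$ (with $\mathrm{dist}(x,\emptyset)=+\infty$), and $\Pi_C(x)=\operatorname{argmin}_{y\in C}\|x-y\|$ is the set of projections. $[f\le a]=\{x: f(x)\le a\}$. The five conditions (each asserts existence of a positive constant; if $\nu=+\infty$ they are global): (SC) there is $\mu_{\mathrm s}>0$ with $f(x)+\langle g,y-x\rangle+\frac{\mu_{\mathrm s}}{2}\|y-x\|^2\le f(y)$ for all $x,y\in[f\le f^\star+\nu]$, $g\in\hat\partial f(x)$. (RSI) there is $\mu_{\mathrm r}>0$ with $\mu_{\mathrm r}\,\mathrm{dist}^2(x,S)\le\langle g,x-\hat x\rangle$ for all $x\in[f\le f^\star+\nu]$, $g\in\hat\partial f(x)$, $\hat x\in\Pi_S(x)$. (EB) there is $\mu_{\mathrm e}>0$ with $\mathrm{dist}(x,S)\le\mu_{\mathrm e}\,\mathrm{dist}(0,\hat\partial f(x))$ for all $x\in[f\le f^\star+\nu]$.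 (PL) there is $\mu_{\mathrm p}>0$ with $2\mu_{\mathrm p}(f(x)-f^\star)\le\mathrm{dist}^2(0,\hat\partial f(x))$ for all $x\in[f\le f^\star+\nu]$. (QG) there is $\mu_{\mathrm q}>0$ with $\frac{\mu_{\mathrm q}}{2}\,\mathrm{dist}^2(x,S)\le f(x)-f^\star$ for all $x\in[f\le f^\star+\nu]$. The constants need not be the same across the conditions. *)

(* Defs.v *)
From mathcomp Require Import all_boot all_order all_algebra.
From mathcomp Require Import all_classical all_reals all_analysis.

Set Implicit Arguments.
Unset Strict Implicit.
Unset Printing Implicit Defensive.

Import Order.TTheory GRing.Theory Num.Theory.
Import numFieldNormedType.Exports.

Local Open Scope classical_set_scope.
Local Open Scope ring_scope.

Section euclidean.
Context {R : realType} {n : nat}.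
Implicit Types (x y u v : 'rV[R]_n) (C : set 'rV[R]_n).

Definition dotp u v : R := \sum_(i < n) u ord0 i * v ord0 i.

(* The library norm on 'rV[R]_n is the sup norm; its topology is the Euclidean
   one, so [closed] and [x^'] below need no adaptation. *)
Definition enorm u : R := Num.sqrt (dotp u u).

(* The infimum is a minimum when C is closed and nonempty; it is +oo when C is
   empty. *)
Definition edistance x C : \bar R := ereal_inf [set (enorm (x - y))%:E | y in C].

Definition projections x C : set 'rV[R]_n :=
  [set y | C y /\ forall z, C z -> enorm (x - y) <= enorm (x - z)].

End euclidean.

Section extended_real_functions.
Context {R : realType} {n : nat}.
Implicit Types (f : 'rV[R]_n -> \bar R) (x : 'rV[R]_n) (nu : \bar R).

Definition proper_fun f : Prop :=
  (forall x, (-oo < f x)%E) /\ (exists x, (f x < +oo)%E).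

(* [R^o] is [R] seen as a module over itself, so that the product is one too. *)
Definition epigraph f : set ('rV[R]_n * R^o) := [set p | (f p.1 <= p.2%:E)%E].

Definition closed_fun f : Prop := closed (epigraph f).

Definition convex_fun f : Prop := convex_set (epigraph f).

Definition weakly_convex (rho : R) f : Prop :=
  convex_fun (fun x => (f x + (rho / 2 * enorm x ^+ 2)%:E)%E).

Definition minval f : \bar R := ereal_inf (range f).

Definition argmin f : set 'rV[R]_n := [set x | forall y, (f x <= f y)%E].

(* Empty at the points where f is infinite. *)
Definition frechet_subdiff f x : set 'rV[R]_n :=
  [set s | f x \is a fin_num /\
    (0 <= limf_einf (fun y => (f y - f x - (dotp s (y - x))%:E)
                              * ((enorm (y - x))^-1)%:E) x^')%E].

(* [nu = +oo] gives the whole space, points with [f x = +oo] included. *)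
Definition sublevel f nu : set 'rV[R]_n :=
  [set x | (f x <= minval f + nu)%E].

Definition SC_with f nu (mu : R) : Prop :=
  forall x y g, sublevel f nu x -> sublevel f nu y -> frechet_subdiff f x g ->
    (f x + (dotp g (y - x) + mu / 2 * enorm (y - x) ^+ 2)%:E <= f y)%E.

Definition RSI_with f nu (mu : R) : Prop :=
  forall x g z, sublevel f nu x -> frechet_subdiff f x g ->
    projections x (argmin f) z ->
    (mu%:E * edistance x (argmin f) ^+ 2 <= (dotp g (x - z))%:E)%E.

Definition EB_with f nu (mu : R) : Prop :=
  forall x, sublevel f nu x ->
    (edistance x (argmin f) <= mu%:E * edistance 0%R (frechet_subdiff f x))%E.

Definition PL_with f nu (mu : R) : Prop :=
  forall x, sublevel f nu x ->
    ((2 * mu)%:E * (f x - minval f)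
       <= edistance 0%R (frechet_subdiff f x) ^+ 2)%E.

Definition QG_with f nu (mu : R) : Prop :=
  forall x, sublevel f nu x ->
    ((mu / 2)%:E * edistance x (argmin f) ^+ 2 <= f x - minval f)%E.

Definition SC f nu : Prop := exists2 mu : R, 0 < mu & SC_with f nu mu.
Definition RSI f nu : Prop := exists2 mu : R, 0 < mu & RSI_with f nu mu.
Definition EB f nu : Prop := exists2 mu : R, 0 < mu & EB_with f nu mu.
Definition PL f nu : Prop := exists2 mu : R, 0 < mu & PL_with f nu mu.
Definition QG f nu : Prop := exists2 mu : R, 0 < mu & QG_with f nu mu.

End extended_real_functions.

(* Main.v *)
Require Import Defs.
From mathcomp Require Import all_boot all_order all_algebra.
From mathcomp Require Import all_classical all_reals all_analysis.
From mathcomp Require Import ring lra.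

(** Write fmin for the minimum of f, S for the set of minimizers, d for the
    distance from x to S and z for a projection of x on S; it exists because S is closed
    (f is lower semicontinuous) and balls are compact.

    The implications other than (PL) => (QG), and (PL) => (EB) which rests on it,
    are pointwise. They compare x with z, mostly through the inequality
      f y >= f x + <g, y - x> - rho/2 |y - x|^2   for every y,
    valid for a Frechet subgradient g of a rho-weakly convex function
    ([weakly_convex_subgradient]): convexity along the segment from x to y
    propagates the first-order behaviour of f at x to the whole segment.
    (SC) => (RSI) is (SC) at the pair (x, z); (RSI) => (EB) is Cauchy-Schwarz.
    For (EB) => (PL), take y = z: f x - fmin <= |g| d + rho/2 d^2, where (EB)
    bounds d by a multiple of |g|. The same inequality at y = z gives
    <g, x - z> >= f x - fmin - rho/2 d^2, and (QG) with mu_q > rho makes the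
    right-hand side at least (mu_q - rho)/2 d^2, which is (RSI).
    (PL) => (EB) chains (QG), obtained from (PL), with (PL).

    The global step is (PL) => (QG) ([PL_QG]), and it does not involve
    convexity. A proximal step from x minimizes f + lam/2 |. - x|^2; its
    output y comes with the Frechet subgradient lam (x - y)
    ([proximal_step]). For lam = mu/3, (PL) at y shows that the gap f - fmin is
    divided by at least 4 while the displacement is at most a constant K times
    sqrt (f x - fmin). Iterating, the displacements would form a geometric series
    of ratio 1/2 ending in S, so d <= 2 K sqrt (f x - fmin), which is (QG).
    [geometric_descent] obtains the endpoint without a limit: it minimizes f
    over the compact set of the points whose gap and distance to the start are
    compatible with that total length. A step from the minimizer stays in this
    set and divides the gap by at least 4, so the gap of the minimizer is zero. *)

Set Implicit Arguments.
Unset Strict Implicit.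
Unset Printing Implicit Defensive.

Import Order.TTheory GRing.Theory Num.Theory.
Import numFieldNormedType.Exports.

Local Open Scope classical_set_scope.
Local Open Scope ring_scope.

(** * Euclidean geometry of row vectors *)

Section euclidean_space.
Context {R : realType} {n : nat}.
Implicit Types (u v w x y z : 'rV[R]_n) (C : set 'rV[R]_n) (a c : R).

Lemma dotpC u v : dotp u v = dotp v u.
Proof. by apply: eq_bigr => i _; rewrite mulrC. Qed.

Lemma dotpDl u v w : dotp (u + v) w = dotp u w + dotp v w.
Proof. by rewrite -big_split; apply: eq_bigr => i _; rewrite mxE mulrDl. Qed.

Lemma dotpZl a u v : dotp (a *: u) v = a * dotp u v.
Proof. by rewrite mulr_sumr; apply: eq_bigr => i _; rewrite mxE mulrA. Qed.

Lemma dotpNl u v : dotp (- u) v = - dotp u v.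
Proof. by rewrite -scaleN1r dotpZl mulN1r. Qed.

Lemma dotpDr u v w : dotp w (u + v) = dotp w u + dotp w v.
Proof. by rewrite dotpC dotpDl !(dotpC w). Qed.

Lemma dotpZr a u v : dotp v (a *: u) = a * dotp v u.
Proof. by rewrite dotpC dotpZl dotpC. Qed.

Lemma dotpNr u v : dotp v (- u) = - dotp v u.
Proof. by rewrite dotpC dotpNl dotpC. Qed.

Definition dotpE := (dotpDl, dotpDr, dotpNl, dotpNr, dotpZl, dotpZr).

Lemma dotp_ge0 u : 0 <= dotp u u.
Proof. by apply: sumr_ge0 => i _; rewrite -expr2 sqr_ge0. Qed.

Lemma dotp_eq0 u : (dotp u u == 0) = (u == 0).
Proof.
apply/eqP/eqP => [u0|->]; last by rewrite /dotp big1// => i _; rewrite mxE mul0r.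
apply/rowP => i; rewrite mxE; apply/eqP; rewrite -sqrf_eq0 expr2; apply/eqP.
by apply: (psumr_eq0P _ u0) => // j _; rewrite -expr2 sqr_ge0.
Qed.

Lemma enorm_ge0 u : 0 <= enorm u.
Proof. exact: sqrtr_ge0. Qed.

Lemma sqr_enorm u : enorm u ^+ 2 = dotp u u.
Proof. by rewrite sqr_sqrtr// dotp_ge0. Qed.

Lemma enorm_eq0 u : (enorm u == 0) = (u == 0).
Proof. by rewrite -sqrf_eq0 sqr_enorm dotp_eq0. Qed.

Lemma enorm_gt0 u : (0 < enorm u) = (u != 0).
Proof. by rewrite lt_def enorm_ge0 enorm_eq0 andbT. Qed.

Lemma enorm0 : enorm (0 : 'rV[R]_n) = 0.
Proof. by apply/eqP; rewrite enorm_eq0. Qed.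

Lemma enormN u : enorm (- u) = enorm u.
Proof. by rewrite /enorm !dotpE opprK. Qed.

Lemma enormB u v : enorm (u - v) = enorm (v - u).
Proof. by rewrite -opprB enormN. Qed.

Lemma enormZ a u : 0 <= a -> enorm (a *: u) = a * enorm u.
Proof.
move=> a0; rewrite /enorm !dotpE mulrA -expr2 sqrtrM ?sqr_ge0//.
by rewrite sqrtr_sqr ger0_norm.
Qed.

(** The squared norm of <u, u> v - <u, v> u is nonnegative, and it equals
    <u, u> (<u, u> <v, v> - <u, v>^2). *)
Lemma cauchy_schwarz u v : dotp u v <= enorm u * enorm v.
Proof.
have [->|u0] := eqVneq u 0.
  by rewrite enorm0 mul0r /dotp big1// => i _; rewrite mxE mul0r.
have uu : 0 < dotp u u by rewrite -sqr_enorm exprn_gt0// enorm_gt0.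
rewrite real_leNgt ?num_real//; apply/negP => lt_uv.
have := dotp_ge0 (dotp u u *: v - dotp u v *: u).
rewrite (_ : dotp _ _ = dotp u u * (dotp u u * dotp v v - dotp u v ^+ 2));
  last by rewrite !dotpE (dotpC v u); ring.
have lt2 : (enorm u * enorm v) ^+ 2 < dotp u v ^+ 2.
  by rewrite ltr_pXn2r// nnegrE ?mulr_ge0 ?enorm_ge0// (le_trans _ (ltW lt_uv))
    ?mulr_ge0 ?enorm_ge0.
rewrite pmulr_rge0// subr_ge0 leNgt.
by rewrite -!sqr_enorm -exprMn lt2.
Qed.

Lemma enormD u v : enorm (u + v) <= enorm u + enorm v.
Proof.
rewrite -(@ler_pXn2r _ 2)// ?nnegrE ?addr_ge0 ?enorm_ge0//.
rewrite sqrrD !sqr_enorm !dotpE (dotpC v u) -subr_ge0.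
have := cauchy_schwarz u v; lra.
Qed.

Lemma enorm_continuous : continuous (@enorm R n).
Proof.
move=> u; apply: (@continuous_comp _ _ _ (fun u => dotp u u) Num.sqrt);
  last exact: sqrt_continuous.
move: u; apply: continuous_big => [|i _ u]; first exact: add_continuous.
by apply: (@cvgM _ _ (nbhs u) (nbhs_filter u)); exact: coord_continuous.
Qed.

Lemma enorm_subl_continuous x : continuous (fun y => enorm (x - y)).
Proof.
move=> y; apply: (@continuous_comp _ _ _ (fun y => x - y) (@enorm R n)).
  by apply: continuousB => //; exact: cst_continuous.
exact: enorm_continuous.
Qed.

(** Transfers boundedness from the Euclidean norm to the sup norm, the one that
    the compactness criterion for row vectors refers to. *)
Lemma mxnorm_le_enorm u : `|u| <= enorm u.
Proof.
rewrite [leLHS]/Num.Def.normr /= mx_normrE; apply/bigmax_leP; split=> [|[i j] _ /=].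
  exact: enorm_ge0.
rewrite (ord1 i) -sqrtr_sqr ler_wsqrtr// /dotp (bigD1 j)//= -expr2 lerDl.
by apply: sumr_ge0 => k _; rewrite -expr2 sqr_ge0.
Qed.

Lemma eball_compact x r : compact [set y | enorm (x - y) <= r].
Proof.
apply: bounded_closed_compact.
  exists (`|x| + r); split; first exact: num_real.
  move=> M ltM y /= xyr; apply: ltW; apply: le_lt_trans ltM.
  rewrite -[y](subKr x) (le_trans (ler_normB _ _))// lerD2l.
  exact: le_trans (mxnorm_le_enorm _) xyr.
rewrite [X in closed X](_ : _ = (fun y => enorm (x - y)) @^-1` [set t | t <= r])//.
by apply: closed_comp (@closed_le _ r) => y _; exact: enorm_subl_continuous.
Qed.

Lemma projection_exists x C : closed C -> C !=set0 -> projections x C !=set0.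
Proof.
move=> clC [c Cc].
have [|||z /[!inE] -[Cz zc] minz] :=
    @compact_EVT_min _ R (fun y => enorm (x - y))
      (C `&` [set y | enorm (x - y) <= enorm (x - c)]).
- by exists c; split=> /=.
- by rewrite setIC; apply: compact_closedI => //; exact: eball_compact.
- by apply: continuous_subspaceT; exact: enorm_subl_continuous.
exists z; split=> // y Cy.
have [xyc|/ltW] := leP (enorm (x - y)) (enorm (x - c)).
  by apply: minz; rewrite inE.
exact: le_trans.
Qed.

Lemma edistance_projection x C z :
  projections x C z -> edistance x C = (enorm (x - z))%:E.
Proof.
move=> [Cz minz]; apply/eqP; rewrite eq_le; apply/andP; split.
  by apply: ereal_inf_lbound; exists z.
by apply: le_ereal_inf_tmp => _ [y Cy <-]; rewrite lee_fin minz.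
Qed.

(** A bound on every squared norm passes to the squared infimum. It includes the
    case of an empty C, where the right-hand side is infinite. *)
Lemma edistance0_sqr_ge c C : 0 <= c ->
  (forall g, C g -> c <= enorm g ^+ 2) -> (c%:E <= edistance 0 C ^+ 2)%E.
Proof.
move=> c0 lec; rewrite -(sqr_sqrtr c0).
have le_sqrt : ((Num.sqrt c)%:E <= edistance 0 C)%E.
  apply: le_ereal_inf_tmp => _ [g Cg <-]; rewrite sub0r enormN lee_fin.
  by rewrite -(ger0_norm (enorm_ge0 g)) -sqrtr_sqr ler_wsqrtr ?lec.
have s0 : (0 <= (Num.sqrt c)%:E)%E by rewrite lee_fin sqrtr_ge0.
by rewrite EFin_expe lee_sqr// (le_trans s0).
Qed.

End euclidean_space.

(** * Lower semicontinuous extended real functions *)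

Section lower_semicontinuity.
Context {R : realType}.

Lemma ereal_between (a b : \bar R) : (a < b)%E ->
  exists r : R, (a < r%:E)%E /\ (r%:E < b)%E.
Proof.
move: a b => [a||] [b||]//=.
- by rewrite lte_fin => ab; exists ((a + b) / 2); rewrite !lte_fin; lra.
- by move=> _; exists (a + 1); rewrite lte_fin ltrDl ltr01 ltry.
- by move=> _; exists (b - 1); rewrite ltNyr lte_fin gtrBl ltr01.
- by move=> _; exists 0; rewrite ltNyr ltry.
Qed.

Lemma lsc_addr_continuous (T : topologicalType) (f : T -> \bar R) (h : T -> R) :
  lower_semicontinuous f -> continuous h ->
  lower_semicontinuous (fun x => (f x + (h x)%:E)%E).
Proof.
move=> lf ch x a; rewrite -lteBlDr//= -EFinB => /ereal_between[b [ab bf]].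
have [V xV Vb] := lf _ _ bf.
exists (V `&` [set y | a - b < h y]).
  apply: filterI => //; apply: (cvgr_gt (h x) (ch x)).
  by move: ab; rewrite lte_fin; lra.
move=> y [/Vb bfy /= ahy]; rewrite -lteBlDr//= -EFinB.
by apply: lt_trans bfy; rewrite lte_fin; lra.
Qed.

(** The strict sublevel sets of f on A above the infimum generate a proper
    filter; lower semicontinuity prevents f from exceeding the infimum at a
    cluster point of it. *)
Lemma lsc_attains_min (T : topologicalType) (f : T -> \bar R) (A : set T) :
  compact A -> A !=set0 -> lower_semicontinuous f ->
  exists2 x, A x & forall y, A y -> (f x <= f y)%E.
Proof.
move=> cA [x0 Ax0] lf; set m := ereal_inf (f @` A).
have le_m y : A y -> (m <= f y)%E by move=> Ay; apply: ereal_inf_lbound; exists y.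
have [my|] := eqVneq m +oo%E.
  by exists x0 => // y /le_m; rewrite my leye_eq => /eqP ->; rewrite leey.
rewrite -ltey => /ereal_between[b [mb _]].
pose D := [set r : R | (m < r%:E)%E].
pose B (r : R) := A `&` [set x | (f x < r%:E)%E].
have FF : Filter (filter_from D B).
  apply: filter_from_filter; first by exists b.
  move=> r s Dr Ds; exists (Num.min r s); first by rewrite /D /= EFin_min lt_min Dr.
  by move=> x [Ax /=]; rewrite EFin_min lt_min => /andP[].
have PF : ProperFilter (filter_from D B).
  apply: filter_from_proper => r /ereal_inf_lt[_ [x Ax <-] fxr].
  by exists x.
have [|p [Ap clp]] := cA _ PF; first by exists b => // x [].
exists p => // y /le_m; apply: le_trans; rewrite leNgt; apply/negP.
move=> /ereal_between[r [mr /lf[V pV Vr]]].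
have [|x [[_ /= fxr] /Vr]] := clp (B r) V _ pV; first by exists r.
by rewrite ltNge (ltW fxr).
Qed.

Lemma closed_fun_lsc (n : nat) (f : 'rV[R]_n -> \bar R) :
  closed_fun f -> lower_semicontinuous f.
Proof.
move=> clf; apply/lower_semicontinuousP => a.
rewrite -[X in open X]setCK openC.
rewrite (_ : ~` _ = (fun x => (x, a : R^o)) @^-1` epigraph f); last first.
  by apply/seteqP; split=> x /=; rewrite /epigraph /= leNgt => /negP.
apply: closed_comp clf => x _.
apply: (@cvg_pair _ _ _ (nbhs x) (nbhs x) (nbhs (a : R^o)) _ _ _ id (fun=> a)).
  exact: cvg_id.
exact: cvg_cst.
Qed.

Lemma lsc_closed_le (T : topologicalType) (f : T -> \bar R) (h : T -> R) :
  lower_semicontinuous f -> continuous h -> closed [set x | (f x <= (h x)%:E)%E].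
Proof.
move=> lf ch.
have cNh : continuous (- h) by move=> x; apply: continuousN; exact: ch.
have lfh := lsc_addr_continuous lf cNh.
have := (lower_semicontinuousP _).1 lfh 0.
rewrite -[X in open X]setCK openC; congr closed.
apply/seteqP; split => x /=.
  by move/negP; rewrite -leNgt EFinN leeBlDr// add0e.
by move=> fh; apply/negP; rewrite -leNgt EFinN leeBlDr// add0e.
Qed.

End lower_semicontinuity.

(** * Frechet subgradients and quadratic minorants *)

Section frechet_subdifferential.
Context {R : realType} {n : nat}.
Implicit Types (f : 'rV[R]_n -> \bar R) (x y s : 'rV[R]_n) (c rho : R).

(** A quadratic error is negligible with respect to |y - x|, so an affine minorant
    up to such an error is a Frechet subgradient. *)
Lemma proximal_subgradient f x s c : 0 <= c -> f x \is a fin_num ->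
  (forall y, (f x + (dotp s (y - x) - c * enorm (y - x) ^+ 2)%:E <= f y)%E) ->
  frechet_subdiff f x s.
Proof.
move=> c0 fx minor; split=> //; rewrite limf_einfE; apply/lee_addgt0Pr => e e0.
rewrite -leeBlDr// add0e; apply: le_ereal_sup_tmp.
exists (ereal_inf [set ((f y - f x - (dotp s (y - x))%:E)
    * ((enorm (y - x))^-1)%:E)%E | y in [set y | c * enorm (x - y) < e]]).
  exists [set y | c * enorm (x - y) < e] => //.
  suff : \forall y \near x, c * enorm (x - y) < e by apply: filterS.
  have cvg0 : (fun y => c * enorm (x - y)) @ x --> (0 : R).
    rewrite (_ : 0 = c * enorm (x - x)); last by rewrite subrr enorm0 mulr0.
    apply: (@cvgMl_tmp _ _ (nbhs x)); exact: enorm_subl_continuous.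
  exact: (cvgr_lt 0 cvg0).
apply: le_ereal_inf_tmp => _ [y /= ye <-].
have le1 : ((- (c * enorm (y - x) ^+ 2))%:E
    <= f y - f x - (dotp s (y - x))%:E)%E.
  rewrite leeBrDr// leeBrDl// -EFinD (le_trans _ (minor y))//.
  by rewrite leeD2l// lee_fin; lra.
have inv0 : (0 <= ((enorm (y - x))^-1)%:E)%E by rewrite lee_fin invr_ge0 enorm_ge0.
apply: le_trans (lee_wpmul2r inv0 le1).
rewrite -EFinM lee_fin mulNr lerN2 -mulrA expr2.
have [->|yx0] := eqVneq (enorm (y - x)) 0; first by rewrite invr0 !mulr0 ltW.
by rewrite mulfK// enormB ltW.
Qed.

(** If the inequality failed at y by an amount - D > 0, then convexity of
    f + rho/2 |.|^2 would keep the difference quotient of f at the points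
    x + t (y - x), 0 < t < 1, at most D / |y - x| < 0. These points tend to x, so
    the lower limit would be negative. *)
Lemma weakly_convex_subgradient f rho x s y :
  0 <= rho -> (forall x, (-oo < f x)%E) -> weakly_convex rho f ->
  frechet_subdiff f x s ->
  (f x + (dotp s (y - x) - rho / 2 * enorm (y - x) ^+ 2)%:E <= f y)%E.
Proof.
move=> rho0 fNy cvxf [+ lim0].
case fxE : (f x) => [a||]// _; have := fNy y.
case fyE : (f y) => [b||]// _; last by rewrite leey.
rewrite -EFinD lee_fin leNgt; apply/negP => lt_b.
have yx : y != x.
  apply/eqP => yxE; move: lt_b; move: fyE; rewrite yxE fxE => -[->].
  by rewrite subrr enorm0 /dotp big1 => [|i _]; rewrite ?mxE ?mulr0//; lra.
have yx0 : 0 < enorm (y - x) by rewrite enorm_gt0 subr_eq0.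
(* The quadratic terms of the convexity inequality combine through
     (1 - t) |x|^2 + t |y|^2 - |x + t (y - x)|^2 = t (1 - t) |y - x|^2. *)
have seg (t : R) : 0 < t -> t < 1 ->
    (f (x + t *: (y - x))%R <= ((1 - t) * a + t * b
       + rho / 2 * (t * (1 - t)) * enorm (y - x) ^+ 2)%:E)%E.
  move=> t0 t1; pose p := Itv01 (ltW t0) (ltW t1).
  pose F z := (f z + (rho / 2 * enorm z ^+ 2)%:E)%E.
  have epi z r : f z = r%:E -> (z, r + rho / 2 * enorm z ^+ 2) \in epigraph F.
    by move=> fz; rewrite inE /epigraph /= /F fz EFinD.
  have := cvxf _ _ p (epi _ _ fyE) (epi _ _ fxE).
  rewrite inE /epigraph /= /F -leeBrDr//.
  rewrite [X in f X](_ : _ = x + t *: (y - x)); last first.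
    by apply/rowP => i; rewrite !mxE /= /unstable.onem; ring.
  move=> /le_trans; apply; rewrite -EFinN -EFinD lee_fin /unstable.onem !sqr_enorm !dotpE.
  rewrite (dotpC y x) /= /GRing.scale /= le_eqVlt; apply/orP; left; apply/eqP.
  ring.
pose D := b - a - dotp s (y - x) + rho / 2 * enorm (y - x) ^+ 2.
have D0 : D < 0 by rewrite /D; lra.
suff : (limf_einf (fun z => (f z - f x - (dotp s (z - x))%:E)
                              * ((enorm (z - x))^-1)%:E) x^'
        <= (D / enorm (y - x))%:E)%E.
  move=> /(le_trans lim0); rewrite lee_fin.
  by rewrite pmulr_lge0 ?invr_gt0// leNgt D0.
rewrite limf_einfE; apply: ge_ereal_sup => _ [V xV <-].
have cont : (fun t : R => x + t *: (y - x)) @ (0 : R) --> x.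
  rewrite -[X in _ --> X]addr0 (_ : 0 = 0 *: (y - x)); last by rewrite scale0r.
  by apply: cvgD; [exact: cvg_cst|apply: cvgZr_tmp; exact: cvg_id].
have {cont}[t [Vt t0 t1]] : exists t : R, [/\ (x + t *: (y - x) != x ->
    V (x + t *: (y - x))), 0 < t & t < 1].
  near (0 : R)^'+ => t; exists t; split.
  - by near: t; exact: (cvg_at_right_filter cont xV).
  - by near: t; exact: nbhs_right_gt.
  - by near: t; exact: nbhs_right_lt.
set z := x + t *: (y - x) in Vt.
have zx : z - x = t *: (y - x) by rewrite /z addrC addKr.
have zx0 : 0 < enorm (z - x) by rewrite zx (enormZ _ (ltW t0)) mulr_gt0.
apply: ge_ereal_inf; exists (((f z - f x - (dotp s (z - x))%:E)
    * ((enorm (z - x))^-1)%:E)%E).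
  by exists z => //; apply: Vt; rewrite -subr_eq0 -enorm_eq0 gt_eqF.
have := seg t t0 t1; rewrite -/z; have := fNy z.
case: (f z) => [d||]// _; rewrite lee_fin => le_d.
rewrite fxE -!EFinB -EFinM lee_fin zx (enormZ _ (ltW t0)) dotpZr invfM mulrA.
rewrite ler_pM2r ?invr_gt0// ler_pdivrMr// /D.
set N := enorm _ in le_d *; set P := dotp _ _.
have : 0 <= t ^+ 2 * (rho / 2 * N ^+ 2).
  exact: mulr_ge0 (sqr_ge0 _) (mulr_ge0 (divr_ge0 rho0 (ler0n _ 2)) (sqr_ge0 _)).
lra.
Unshelve. all: by end_near.
Qed.

End frechet_subdifferential.

(** * Distance from the origin to the subdifferential *)

Section subdifferential_distance.
Context {R : realType} {n : nat}.
Implicit Types (g x : 'rV[R]_n) (C : set 'rV[R]_n) (c mu : R).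

Lemma edistance0_le g C : C g -> (edistance 0 C <= (enorm g)%:E)%E.
Proof. by move=> Cg; apply: ereal_inf_lbound; exists g; rewrite ?sub0r ?enormN. Qed.

Lemma edistance0_sqr_le g C : C g -> (edistance 0 C ^+ 2 <= (enorm g ^+ 2)%:E)%E.
Proof.
move=> Cg; rewrite EFin_expe lee_sqr ?lee_fin ?enorm_ge0 ?edistance0_le//.
by apply: le_ereal_inf_tmp => _ [y _ <-]; rewrite lee_fin enorm_ge0.
Qed.

Lemma le_mul_edistance0 c mu C : 0 < mu ->
  (forall g, C g -> c <= mu * enorm g) -> (c%:E <= mu%:E * edistance 0 C)%E.
Proof.
move=> mu0 lec; rewrite -lee_pdivrMl// -EFinM.
apply: le_ereal_inf_tmp => _ [g Cg <-].
by rewrite sub0r enormN lee_fin ler_pdivrMl// lec.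
Qed.

Lemma edistance_set0 x C : ~ (C !=set0) -> edistance x C = +oo%E.
Proof.
by move=> /set0P/negP; rewrite negbK => /eqP->; rewrite /edistance image_set0 ereal_inf0.
Qed.

End subdifferential_distance.

(** * Proximal steps and geometric descent *)

Section descent.
Context {R : realType} {n : nat}.
Implicit Types (f : 'rV[R]_n -> \bar R) (x y z : 'rV[R]_n) (m a b K lam : R).

(** The point y minimizes f + lam/2 |x - .|^2, hence
    f w >= f y + lam/2 |x - y|^2 - lam/2 |x - w|^2 for all w, and the right-hand
    side is f y + <lam (x - y), w - y> - lam/2 |w - y|^2. *)
Lemma proximal_step f m lam x a : 0 < lam -> lower_semicontinuous f ->
  (forall y, (m%:E <= f y)%E) -> f x = a%:E ->
  exists y b, [/\ f y = b%:E, b + lam / 2 * enorm (x - y) ^+ 2 <= a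
    & frechet_subdiff f y (lam *: (x - y))].
Proof.
move=> lam0 lf le_m fx.
(* Outside the ball of radius r the penalty alone exceeds a - m, so the minimum
   over this ball is global. *)
pose r := Num.sqrt (2 / lam * (a - m)).
have am : m <= a by rewrite -lee_fin -fx.
have r2 : lam / 2 * r ^+ 2 = a - m.
  rewrite sqr_sqrtr; last by rewrite mulr_ge0 ?subr_ge0// divr_ge0// ltW.
  by field; rewrite gt_eqF.
have ch : continuous (fun y => lam / 2 * enorm (x - y) ^+ 2).
  move=> y; apply: (@cvgMl_tmp _ _ (nbhs y)).
  by apply: (@cvgM _ _ (nbhs y)); exact: enorm_subl_continuous.
have [|y xyr miny] := lsc_attains_min (@eball_compact _ _ x r) _ (lsc_addr_continuous lf ch).
  by exists x => /=; rewrite subrr enorm0 sqrtr_ge0.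
have Fy w : (f y + (lam / 2 * enorm (x - y) ^+ 2)%:E
    <= f w + (lam / 2 * enorm (x - w) ^+ 2)%:E)%E.
  have [xwr|rxw] := leP (enorm (x - w)) r; first exact: miny.
  apply: (@le_trans _ _ a%:E).
    rewrite (le_trans (miny x _))//= subrr enorm0 ?sqrtr_ge0// fx -EFinD lee_fin.
    by rewrite expr0n/= mulr0 addr0.
  rewrite (_ : a = m + lam / 2 * r ^+ 2); last by rewrite r2; ring.
  rewrite EFinD leeD// lee_fin ler_pM2l ?divr_gt0//.
  by rewrite ler_pXn2r ?nnegrE ?sqrtr_ge0 ?enorm_ge0// ltW.
have := Fy x; rewrite subrr enorm0 expr0n/= mulr0 adde0 fx; have := le_m y.
case fy : (f y) => [b||]// _; rewrite -EFinD lee_fin => le_b.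
exists y, b; split=> //; apply: (@proximal_subgradient _ _ _ _ _ (lam / 2)).
- by rewrite divr_ge0// ltW.
- by rewrite fy.
move=> w; have := Fy w; rewrite fy -leeBlDr// => /(le_trans _); apply.
rewrite -EFinN -!EFinD lee_fin !sqr_enorm !dotpE.
rewrite (dotpC y x) (dotpC w x) (dotpC w y) le_eqVlt; apply/orP; left; apply/eqP.
by field.
Qed.

(** Each step at least halves sqrt (f - m), so 2 K sqrt (f x - m) bounds the length of the
    path that the steps would still follow from x. The set A below consists of
    the points x for which |x0 - x| plus this remaining length is at most
    2 K sqrt (a0 - m). It is compact and stable under the steps, so a minimizer
    of f over A cannot be improved by a step and has f = m. *)
Lemma geometric_descent f m K x0 a0 : 0 < K -> lower_semicontinuous f ->
  (forall y, (m%:E <= f y)%E) -> f x0 = a0%:E ->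
  (forall x a, f x = a%:E -> a <= a0 -> exists y b,
    [/\ f y = b%:E, 4 * (b - m) <= a - m & enorm (x - y) <= K * Num.sqrt (a - m)]) ->
  exists2 z, f z = m%:E & enorm (x0 - z) <= 2 * K * Num.sqrt (a0 - m).
Proof.
move=> K0 lf le_m fx0 step.
have le_mr x a : f x = a%:E -> 0 <= a - m.
  by move=> fx; rewrite subr_ge0 -lee_fin -fx.
set s0 := Num.sqrt (a0 - m).
have K2 : 0 < 2 * K by rewrite mulr_gt0.
(* Membership in A is sqrt (f y - m) <= q y; it is encoded without the root so
   that closedness follows from lower semicontinuity. *)
pose q y := s0 - enorm (x0 - y) / (2 * K).
have q_ge0 y : (0 <= q y) = (enorm (x0 - y) <= 2 * K * s0).
  by rewrite subr_ge0 ler_pdivrMr// mulrC.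
have cq : continuous (fun y => m + q y ^+ 2).
  have cq1 y : {for y, continuous q}.
    apply: continuousB; first exact: cst_continuous.
    apply: (@cvgMr_tmp _ _ (nbhs y)); exact: enorm_subl_continuous.
  move=> y; apply: (@cvgD _ _ _ (nbhs y)); first exact: cvg_cst.
  by apply: (@cvgM _ _ (nbhs y)); exact: cq1.
pose A := [set y | enorm (x0 - y) <= 2 * K * s0]
  `&` [set y | (f y <= (m + q y ^+ 2)%:E)%E].
have cA : compact A.
  by apply: compact_closedI; [exact: eball_compact|exact: lsc_closed_le].
have AE y b : f y = b%:E -> A y <-> Num.sqrt (b - m) <= q y.
  move=> fy; split=> [[/= + ]|le_q].
    rewrite -q_ge0 fy lee_fin => q0; rewrite -lerBlDl => le_q.
    by rewrite -(ger0_norm q0) -sqrtr_sqr ler_wsqrtr.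
  have q0 : 0 <= q y by exact: le_trans (sqrtr_ge0 _) le_q.
  split=> /=; first by rewrite -q_ge0.
  rewrite fy lee_fin -lerBlDl -[leLHS]sqr_sqrtr ?(le_mr _ _ fy)//.
  by rewrite ler_pXn2r ?nnegrE ?sqrtr_ge0.
have Ax0 : A x0 by apply/(AE _ _ fx0); rewrite /q subrr enorm0 mul0r subr0.
have [x Ax minx] := lsc_attains_min cA (ex_intro _ x0 Ax0) lf.
have := minx _ Ax0; have := le_m x; rewrite fx0.
case fx : (f x) => [a||]// _; rewrite lee_fin => le_a.
have [y [b [fy le_b le_xy]]] := step _ _ fx le_a.
have sq_a := (AE _ _ fx).1 Ax.
have sq_b : Num.sqrt (b - m) <= Num.sqrt (a - m) / 2.
  rewrite ler_pdivlMr// -(@ler_pXn2r _ 2)// ?nnegrE ?mulr_ge0 ?sqrtr_ge0//.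
  by rewrite exprMn !sqr_sqrtr ?(le_mr _ _ fx) ?(le_mr _ _ fy)//; lra.
have Ay : A y.
  apply/(AE _ _ fy); rewrite /q lerBrDr -lerBrDl ler_pdivrMr//.
  have := sq_a; rewrite /q lerBrDr -lerBrDl ler_pdivrMr// => le_x.
  have := enormD (x0 - x) (x - y); rewrite addrA subrK => tri.
  have := ler_wpM2r (ltW K2) sq_b.
  lra.
have := minx _ Ay; rewrite fx fy lee_fin => le_ab.
have /eqP : a - m = 0.
  by apply/eqP; rewrite eq_le (le_mr _ _ fx) andbT; lra.
rewrite subr_eq0 => /eqP am; exists x; first by rewrite fx am.
by case: Ax.
Qed.

End descent.

(** * Minimizers *)

Section minimizers.
Context {R : realType} {n : nat}.
Implicit Types (f : 'rV[R]_n -> \bar R) (x z : 'rV[R]_n) (nu : \bar R).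

Lemma minval_argmin f z : argmin f z -> minval f = f z.
Proof.
move=> minz; apply/eqP; rewrite eq_le; apply/andP; split.
  by apply: ereal_inf_lbound; exists z.
by apply: le_ereal_inf_tmp => _ [y _ <-].
Qed.

Lemma minval_fin f : proper_fun f -> argmin f !=set0 ->
  exists m : R, minval f = m%:E.
Proof.
move=> [fNy [x fxy]] [z minz]; rewrite (minval_argmin minz).
have := le_lt_trans (minz x) fxy; have := fNy z.
by case: (f z) => [m||]// _ _; exists m.
Qed.

Lemma argminP f z : argmin f !=set0 -> argmin f z <-> f z = minval f.
Proof.
move=> [z0 minz0]; split=> [/minval_argmin//|fz y].
by rewrite fz (minval_argmin minz0).
Qed.

Lemma minval_le f x : (minval f <= f x)%E.
Proof. by apply: ereal_inf_lbound; exists x. Qed.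

Lemma argmin_closed f : closed_fun f -> proper_fun f -> argmin f !=set0 ->
  closed (argmin f).
Proof.
move=> /closed_fun_lsc lf pf S0; have [m fm] := minval_fin pf S0.
rewrite (_ : argmin f = [set x | (f x <= m%:E)%E]).
  by apply: lsc_closed_le => // x; exact: cst_continuous.
apply/seteqP; split=> x /=; rewrite -fm; first by move=> /minval_argmin->.
by move=> fx; apply/(argminP _ S0)/eqP; rewrite eq_le fx minval_le.
Qed.

Lemma argmin_sublevel f nu z : (0 < nu)%E -> argmin f z -> sublevel f nu z.
Proof. by move=> nu0 /minval_argmin fz; rewrite /sublevel /= fz leeDl// ltW. Qed.

End minimizers.

(** * The implications, with constants *)

Section implications.
Context {R : realType} {n : nat} (f : 'rV[R]_n -> \bar R) (nu : \bar R)
  (f_proper : proper_fun f) (f_closed : closed_fun f)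
  (S_neq0 : argmin f !=set0) (nu_gt0 : (0 < nu)%E).
Implicit Types (x y z g : 'rV[R]_n) (mu rho : R).

Let projS x : projections x (argmin f) !=set0.
Proof. exact: projection_exists (argmin_closed f_closed f_proper S_neq0) S_neq0. Qed.

(** (SC) applied to x and its projection z, a point of minimal value. *)
Lemma SC_RSI mu : SC_with f nu mu -> RSI_with f nu (mu / 2).
Proof.
move=> sc x g z xnu gx prz; have [minz _] := prz.
have := sc x z g xnu (argmin_sublevel nu_gt0 minz) gx.
rewrite (edistance_projection prz) -EFin_expe -EFinM lee_fin.
have [+ _] := gx; have := minz x.
have [m] := minval_fin f_proper S_neq0; rewrite (minval_argmin minz) => ->.
case: (f x) => [a||]// le_ma _; rewrite -EFinD !lee_fin in le_ma *.
by rewrite enormB -[x - z]opprB dotpNr; lra.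
Qed.

(** mu d^2 <= <g, x - z> <= |g| d, divided by d. *)
Lemma RSI_EB mu : 0 < mu -> RSI_with f nu mu -> EB_with f nu mu^-1.
Proof.
move=> mu0 rsi x xnu; have [z prz] := projS x.
rewrite (edistance_projection prz); apply: le_mul_edistance0; rewrite ?invr_gt0//.
move=> g gx; have := rsi x g z xnu gx prz.
rewrite (edistance_projection prz) -EFin_expe -EFinM lee_fin => le_rsi.
have [->|xz0] := eqVneq (enorm (x - z)) 0.
  by rewrite mulr_ge0 ?enorm_ge0 ?invr_ge0 ?ltW.
have xz : 0 < enorm (x - z) by rewrite lt_def xz0 enorm_ge0.
rewrite ler_pdivlMl// -(ler_pM2r xz) -mulrA -expr2.
exact: le_trans le_rsi (cauchy_schwarz _ _).
Qed.

(** The subgradient inequality at z gives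
    f x - fmin <= |g| d + rho/2 d^2 <= (mu + rho/2 mu^2) |g|^2, using d <= mu |g|. *)
Lemma EB_PL rho mu : 0 <= rho -> weakly_convex rho f -> 0 < mu ->
  EB_with f nu mu -> PL_with f nu ((2 * (mu + rho / 2 * mu ^+ 2))^-1).
Proof.
move=> rho0 wcf mu0 eb x xnu.
have K0 : 0 < mu + rho / 2 * mu ^+ 2.
  by rewrite ltr_wpDr// mulr_ge0 ?sqr_ge0// divr_ge0.
have [m fm] := minval_fin f_proper S_neq0.
have := minval_le f x; rewrite fm.
have [sub0|nosub] := pselect (frechet_subdiff f x !=set0); last first.
  by rewrite (edistance_set0 _ nosub) expe2 mulyy leey.
have [g0 [+ _]] := sub0; case fx : (f x) => [a||]// _; rewrite lee_fin => ma.
rewrite -EFinB -EFinM (_ : 2 * _ = (mu + rho / 2 * mu ^+ 2)^-1); last first.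
  by rewrite invfM mulrA divff ?mul1r// pnatr_eq0.
apply: edistance0_sqr_ge; first by rewrite mulr_ge0 ?subr_ge0// invr_ge0 ltW.
move=> g gx; rewrite ler_pdivrMl//.
have [z prz] := projS x.
have d_le : enorm (x - z) <= mu * enorm g.
  rewrite -lee_fin -(edistance_projection prz) (le_trans (eb x xnu))//.
  by rewrite EFinM lee_wpmul2l ?edistance0_le// lee_fin ltW.
have := weakly_convex_subgradient z rho0 f_proper.1 wcf gx.
have [minz _] := prz; rewrite -(minval_argmin minz) fm fx -EFinD lee_fin.
rewrite enormB -[z - x]opprB dotpNr => sub.
have := cauchy_schwarz g (x - z).
have le1 : enorm g * enorm (x - z) <= mu * enorm g ^+ 2.
  by rewrite mulrC expr2 mulrA ler_wpM2r ?enorm_ge0.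
have le2 : rho / 2 * enorm (x - z) ^+ 2 <= rho / 2 * (mu * enorm g) ^+ 2.
  apply: ler_wpM2l; first by rewrite divr_ge0.
  by rewrite ler_pXn2r ?nnegrE ?mulr_ge0 ?enorm_ge0// ltW.
rewrite exprMn in le2.
lra.
Qed.

(** A proximal step from x to y has |x - y|^2 <= 2/lam (f x - f y), and (PL) at y
    with the subgradient lam (x - y) gives
    2 mu (f y - fmin) <= lam^2 |x - y|^2 <= 2 lam (f x - f y). With lam = mu/3 this
    is 4 (f y - fmin) <= f x - fmin, so geometric descent with K^2 = 2/lam yields
    d^2 <= 4 K^2 (f x - fmin) = 24/mu (f x - fmin). *)
Lemma PL_QG mu : 0 < mu -> PL_with f nu mu -> QG_with f nu (mu / 12).
Proof.
move=> mu0 pl x0 x0nu.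
have [m fm] := minval_fin f_proper S_neq0.
have le_m y : (m%:E <= f y)%E by rewrite -fm minval_le.
have lf := closed_fun_lsc f_closed.
rewrite fm; have := le_m x0; have := f_proper.1 x0.
case fx0 : (f x0) => [a0||]// _; last by move=> _; rewrite addye// leey.
rewrite lee_fin => ma0.
pose lam := mu / 3; have lam0 : 0 < lam by rewrite divr_gt0.
pose K := Num.sqrt (2 / lam); have K0 : 0 < K by rewrite sqrtr_gt0 divr_gt0.
have K2 : K ^+ 2 = 2 / lam by rewrite sqr_sqrtr// divr_ge0// ltW.
have [|z fz le_z] := geometric_descent K0 lf le_m fx0.
  move=> x a fx le_a.
  have [y [b [fy le_b suby]]] := proximal_step lam0 lf le_m fx.
  have d0 : 0 <= lam / 2 * enorm (x - y) ^+ 2.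
    by rewrite mulr_ge0 ?sqr_ge0// divr_ge0// ltW.
  have mb : m <= b by rewrite -lee_fin -fy.
  have ynu : sublevel f nu y.
    by rewrite /sublevel /= fy (le_trans _ x0nu)// fx0 lee_fin; lra.
  have := le_trans (pl y ynu) (edistance0_sqr_le suby).
  rewrite fy fm -EFinB -EFinM lee_fin (enormZ _ (ltW lam0)) exprMn => plb.
  exists y, b; split=> //.
    have := ler_wpM2l (ltW lam0) le_b; rewrite /lam in plb *; nra.
  rewrite -(@ler_pXn2r _ 2)// ?nnegrE ?mulr_ge0 ?sqrtr_ge0 ?enorm_ge0 ?(ltW K0)//.
  rewrite exprMn K2 (@sqr_sqrtr _ (a - m)); last by rewrite subr_ge0 -lee_fin -fx.
  rewrite mulrAC ler_pdivlMr//; lra.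
have Sz : argmin f z by apply/(argminP _ S_neq0); rewrite fm.
have [p prp] := projS x0.
rewrite (edistance_projection prp) -EFin_expe -EFinM lee_fin.
have le_p := le_trans (prp.2 z Sz) le_z.
have : enorm (x0 - p) ^+ 2 <= (2 * K * Num.sqrt (a0 - m)) ^+ 2.
  by rewrite ler_pXn2r ?nnegrE ?enorm_ge0// (le_trans _ le_p) ?enorm_ge0.
rewrite !exprMn K2 (@sqr_sqrtr _ (a0 - m)) ?subr_ge0// => le_p2.
rewrite -(ler_pM2l (_ : 0 < mu / 24)) in le_p2; last by rewrite divr_gt0.
rewrite (_ : mu / 12 / 2 = mu / 24); last by field.
apply: le_trans le_p2 _; rewrite le_eqVlt; apply/orP; left; apply/eqP.
by rewrite /lam; field; rewrite gt_eqF.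
Qed.

(** muq/2 d^2 <= f x - fmin <= |g|^2 / (2 mup). *)
Lemma PL_QG_EB mup muq : 0 < mup -> 0 < muq ->
  PL_with f nu mup -> QG_with f nu muq ->
  EB_with f nu (Num.sqrt (mup * muq)^-1).
Proof.
move=> mup0 muq0 pl qg x xnu; have [z prz] := projS x.
have M0 : 0 < (mup * muq)^-1 by rewrite invr_gt0 mulr_gt0.
rewrite (edistance_projection prz); apply: le_mul_edistance0.
  by rewrite sqrtr_gt0.
move=> g gx; have := le_trans (pl x xnu) (edistance0_sqr_le gx).
have := qg x xnu; rewrite (edistance_projection prz) -EFin_expe -EFinM.
have [m ->] := minval_fin f_proper S_neq0.
have [+ _] := gx; case: (f x) => [a||]// _; rewrite -EFinB -EFinM !lee_fin.
move=> le_q le_p.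
rewrite -(@ler_pXn2r _ 2)// ?nnegrE ?mulr_ge0 ?sqrtr_ge0 ?enorm_ge0//.
rewrite exprMn (@sqr_sqrtr _ (mup * muq)^-1) ?(ltW M0)// ler_pdivlMl ?mulr_gt0//.
have := ler_wpM2l (ltW mup0) le_q; lra.
Qed.

(** The subgradient inequality at z loses only rho/2 d^2, which (QG) outweighs
    as soon as mu > rho. *)
Lemma QG_RSI rho mu : 0 <= rho -> weakly_convex rho f ->
  QG_with f nu mu -> RSI_with f nu ((mu - rho) / 2).
Proof.
move=> rho0 wcf qg x g z xnu gx prz; have [minz _] := prz.
have := qg x xnu; have := weakly_convex_subgradient z rho0 f_proper.1 wcf gx.
rewrite (edistance_projection prz) -EFin_expe -!EFinM -(minval_argmin minz).
have [m ->] := minval_fin f_proper S_neq0.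
have [+ _] := gx; case: (f x) => [a||]// _; rewrite -EFinB -EFinD !lee_fin.
rewrite (enormB z) -[z - x]opprB dotpNr; lra.
Qed.

End implications.

Lemma convex_weakly_convex0 (R : realType) (n : nat) (f : 'rV[R]_n -> \bar R) :
  convex_fun f -> weakly_convex 0 f.
Proof.
rewrite /weakly_convex; congr convex_fun; apply/funext => x.
by rewrite !mul0r adde0.
Qed.

Theorem theorem3p1 (R : realType) (n : nat) (rho : R)
    (f : 'rV[R]_n -> \bar R) (nu : \bar R)
    (rho_ge0 : 0 <= rho) (f_proper : proper_fun f) (f_closed : closed_fun f)
    (f_wconvex : weakly_convex rho f) (S_neq0 : argmin f !=set0)
    (nu_gt0 : (0 < nu)%E) :
  [/\ SC f nu -> RSI f nu,
      RSI f nu -> EB f nu,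
      EB f nu <-> PL f nu
    & PL f nu -> QG f nu]
  /\
  ((exists2 mu : R, rho < mu & QG_with f nu mu) ->
     [/\ RSI f nu, EB f nu & PL f nu] /\
     [/\ RSI f nu <-> EB f nu, EB f nu <-> PL f nu & PL f nu <-> QG f nu])
  /\
  (convex_fun f ->
     [/\ RSI f nu <-> EB f nu, EB f nu <-> PL f nu & PL f nu <-> QG f nu]).
Proof.
have sc_rsi : SC f nu -> RSI f nu.
  move=> [mu mu0 sc]; exists (mu / 2); first by rewrite divr_gt0.
  exact: SC_RSI.
have rsi_eb : RSI f nu -> EB f nu.
  move=> [mu mu0 rsi]; exists mu^-1; first by rewrite invr_gt0.
  exact: RSI_EB.
have eb_pl : EB f nu -> PL f nu.
  move=> [mu mu0 eb]; exists (2 * (mu + rho / 2 * mu ^+ 2))^-1; last exact: EB_PL.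
  rewrite invr_gt0 mulr_gt0// ltr_wpDr// mulr_ge0 ?sqr_ge0//.
  by rewrite divr_ge0.
have pl_qg : PL f nu -> QG f nu.
  move=> [mu mu0 pl]; exists (mu / 12); first by rewrite divr_gt0.
  exact: PL_QG.
have pl_eb : PL f nu -> EB f nu.
  move=> pl; have [muq muq0 qg] := pl_qg pl; have [mup mup0 plp] := pl.
  exists (Num.sqrt (mup * muq)^-1); last exact: PL_QG_EB.
  by rewrite sqrtr_gt0 invr_gt0 mulr_gt0.
have qg_rsi r : 0 <= r -> weakly_convex r f ->
    (exists2 mu : R, r < mu & QG_with f nu mu) -> RSI f nu.
  move=> r0 wcf [mu ltmu qg]; exists ((mu - r) / 2); last exact: QG_RSI.
  by rewrite divr_gt0// subr_gt0.
split; first by split.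
split=> [qg|cf].
  have rsi := qg_rsi rho rho_ge0 f_wconvex qg.
  by split; split; tauto.
have qg0 := qg_rsi 0 (lexx 0) (convex_weakly_convex0 cf).
by split; split; rewrite /QG in pl_qg *; tauto.
Qed.
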